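(* Let $(M,\rho)$ be a complete metric space, let $(X,E_v)$ be a vertical rooted graph with $\mathcal J_1(x)\ne\emptyset$ for all $x\in X$, and let $\Phi$ be an index map on $(X,E_v)$ over $(M,\rho)$ of exponential type-$(b)$, where $b\in(0,\infty)$. Fix $\gamma>0$. Then the associated $AI_b$-graph $(X,E^{(b)})$ has bounded degree if and only if condition $(S_b)$ is satisfied. Also, the $AI_\infty$-graph $(X,E^{(\infty)})$ has bounded degree provided that $(S_b)$ is satisfied.
   Context: A rooted graph $(X,E)$ is a countable vertex set $X$ with a symmetric edge set $E\subset X\times X\setminus\Delta$ ($\Delta$ the diagonal) that is locally finite and connected, with a fixed root $\vartheta\in X$. Let $d$ be the graph distance, $|x|:=d(\vartheta,x)$, $X_n=\{x:|x|=n\}$. $\mathcal J_1(x)$ is the set of $y$ with $(x,y)\in E$ and $|y|=|x|+1$. The graph is vertical if it has no edges $(x,y)$ with $|x|=|y|$. It has bounded degree if $\sup_{x\in X}\#\{y:(x,y)\in E\}<\infty$. $\mathcal R_v$ denotes the set of rays $[x_i]_{i\ge0}$ with $x_0=\vartheta$ and $x_{i+1}\in\mathcal J_1(x_i)$ for all $i$. Let $\mathcal C_M$ be the family of nonempty compact subsets of $M$. An index map on $(X,E_v)$ over $(M,\rho)$ is a map $\Phi:X\to\mathcal C_M$ with $\Phi(y)\subset\Phi(x)$ for all $x\in X$, $y\in\mathcal J_1(x)$, and such that $\bigcap_{i\ge0}\Phi(x_i)$ is a singleton for every $[x_i]_i\in\mathcal R_v$. Its attractor is $K=\bigcap_{n\ge0}\bigcup_{x\in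 X_n}\Phi(x)$, and $K_x:=\Phi(x)\cap K$. It is of exponential type-$(b)$ if $|\Phi(x)|_\rho=O(e^{-b|x|})$ as $|x|\to\infty$ ($|\cdot|_\rho$ = diameter). Condition $(S_b)$: for any $c>0$ there is a constant $\bar\ell=\bar\ell(c)$ such that $\#\{x\in X_n:K_x\cap F\ne\emptyset\}\le\bar\ell$ for all $n\ge0$ and all $F\subset M$ with $|F|_\rho<ce^{-bn}$. The $AI_b$-graph (for the fixed $\gamma>0$) is $(X,E^{(b)})$ with $E^{(b)}=E_v\cup E_h^{(b)}$, $E_h^{(b)}=\bigcup_{n\ge1}\{(x,y)\in X_n\times X_n\setminus\Delta:\operatorname{dist}_\rho(\Phi(x),\Phi(y))\le\gamma e^{-bn}\}$. The $AI_\infty$-graph is $(X,E^{(\infty)})$ with $E^{(\infty)}=E_v\cup E_h^{(\infty)}$, $E_h^{(\infty)}=\bigcup_{n\ge1}\{(x,y)\in X_n\times X_n\setminus\Delta:\Phi(x)\cap\Phi(y)\ne\emptyset\}$. *)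

(* Defs.v *)
From mathcomp Require Import all_boot all_order all_algebra.
From mathcomp Require Import all_classical all_reals all_analysis.

Set Implicit Arguments.
Unset Strict Implicit.
Unset Printing Implicit Defensive.

Import Order.TTheory GRing.Theory Num.Theory.

Local Open Scope classical_set_scope.
Local Open Scope card_scope.
Local Open Scope ring_scope.

Definition walk (X : Type) (E : set (X * X)) (x y : X) (n : nat) : Prop :=
  exists s : seq X,
    [/\ path (fun u v => `[< E (u, v) >]) x s, last x s = y & size s = n].

Definition graph_dist (X : Type) (E : set (X * X)) (x y : X) : nat :=
  xget 0%N [set n | walk E x y n /\ forall m, walk E x y m -> (n <= m)%N].

Record rooted_graph (X : countType) := RootedGraph {
  edge : set (X * X);
  graph_root : X;
  edge_sym : forall x y, edge (x, y) -> edge (y, x);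
  edge_irrefl : forall x, ~ edge (x, x);
  edge_locally_finite : forall x, finite_set [set y | edge (x, y)];
  edge_connected : forall x y, exists n, walk edge x y n }.

Definition bounded_degree (X : Type) (E : set (X * X)) : Prop :=
  exists N : nat, forall x, [set y | E (x, y)] #<= `I_N.

Section RootedGraph.
Variables (X : countType) (G : rooted_graph X).

Definition level (x : X) : nat := graph_dist (edge G) (graph_root G) x.

Definition sphere (n : nat) : set X := [set x | level x = n].

Definition children (x : X) : set X :=
  [set y | edge G (x, y) /\ level y = (level x).+1].

Definition vertical : Prop :=
  forall x y, edge G (x, y) -> level x <> level y.

Definition ray (x_ : nat -> X) : Prop :=
  x_ 0%N = graph_root G /\ forall i, children (x_ i) (x_ i.+1).

End RootedGraph.

Section Metric.
Variables (R : realType) (M : metricType R).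

Definition complete_metric : Prop :=
  forall u : nat -> M, cauchy (u @ \oo) -> exists l : M, u @ \oo --> l.

(* Adjoining 0 gives the empty set diameter 0 instead of -oo; unbounded sets
   have diameter +oo. *)
Definition diam (A : set M) : \bar R :=
  ereal_sup (0%E |` [set (mdist x y)%:E | x in A & y in A]).

(* Only meaningful for nonempty sets, as inf set0 = 0. *)
Definition set_dist (A B : set M) : R :=
  inf [set mdist x y | x in A & y in B].

Variables (X : countType) (G : rooted_graph X) (Phi : X -> set M).

Record is_index_map : Prop := IndexMap {
  index_map_nonempty : forall x, Phi x !=set0;
  index_map_compact : forall x, compact (Phi x);
  index_map_nested : forall x y, children G x y -> Phi y `<=` Phi x;
  index_map_ray : forall x_ : nat -> X, ray G x_ ->
    exists z : M, \bigcap_(i in [set: nat]) Phi (x_ i) = [set z] }.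

Definition attractor : set M :=
  \bigcap_(n in [set: nat]) \bigcup_(x in sphere G n) Phi x.

Definition cell (x : X) : set M := Phi x `&` attractor.

Definition exponential_type (b : R) : Prop :=
  exists C : R, \forall n \near \oo, forall x, sphere G n x ->
    (diam (Phi x) <= (C * expR (- (b * n%:R)))%:E)%E.

Definition condition_S (b : R) : Prop :=
  forall c : R, 0 < c -> exists l : nat, forall (n : nat) (F : set M),
    (diam F < (c * expR (- (b * n%:R)))%:E)%E ->
    [set x | sphere G n x /\ cell x `&` F !=set0] #<= `I_l.

Definition AI_edge (b gamma : R) : set (X * X) :=
  edge G `|` \bigcup_(n in [set n | (1 <= n)%N]) [set p |
    [/\ sphere G n p.1, sphere G n p.2, p.1 <> p.2 &
        set_dist (Phi p.1) (Phi p.2) <= gamma * expR (- (b * n%:R))]].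

Definition AI_infty_edge : set (X * X) :=
  edge G `|` \bigcup_(n in [set n | (1 <= n)%N]) [set p |
    [/\ sphere G n p.1, sphere G n p.2, p.1 <> p.2 &
        Phi p.1 `&` Phi p.2 !=set0]].

End Metric.

(* Main.v *)
Require Import Defs.
From mathcomp Require Import all_boot all_order all_algebra.
From mathcomp Require Import all_classical all_reals all_analysis.
From mathcomp Require Import zify lra.

(** A ray through [x] shows that every cell [K_x] is nonempty, and nestedness
    together with compactness of [Phi(root)] makes the diameter bound [C
    e^(-bn)] hold on all levels. If [S_b] holds, all neighbours of [x] in [X_n]
    lie in the three levels [n-1], [n], [n+1] and have cells meeting one
    neighbourhood of [Phi x] of diameter [O(e^(-bn))]. Conversely, two vertices
    of [X_n] whose cells meet a set of diameter less than [gamma e^(-bn)] are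
    equal or adjacent, so there are at most [N+1] of them if all degrees are at
    most [N]; a set of diameter less than [gamma e^(bk) e^(-bn)] is handled by
    passing [k] times to parents, each step costing a factor [N+1]. Finally
    [E^(infty)] is contained in [E^(b)]. *)

Set Implicit Arguments.
Unset Strict Implicit.
Unset Printing Implicit Defensive.

Import Order.TTheory GRing.Theory Num.Theory.
Local Open Scope classical_set_scope.
Local Open Scope ring_scope.

(** * Cardinality bounds and degrees of subgraphs *)

Lemma card_le_seq (T : choiceType) (A : set T) (s : seq T) :
  A `<=` [set` s] -> (A #<= `I_(size s))%card.
Proof.
move=> /subset_card_le /card_le_trans; apply.
case: s => [|x s]; first by rewrite set_nil; exact: card_ge0.
apply: (@card_le_trans _ _ _ (nth x (x :: s) @` `I_(size (x :: s)))).
  apply: subset_card_le => y /= ys; exists (index y (x :: s)).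
    by have := ys; rewrite -index_mem.
  by rewrite nth_index.
exact: card_image_le.
Qed.

Lemma card_leU1 (T : choiceType) (x : T) (A : set T) (n : nat) :
  (A #<= `I_n)%card -> (x |` A #<= `I_n.+1)%card.
Proof.
move=> An; have finA : finite_set A by apply/finite_set_leP; exists n.
apply: (@card_le_trans _ _ _ `I_(size (x :: finmap.enum_fset (fset_set A)))).
  apply: card_le_seq => y /= [->|Ay]; first exact: mem_head.
  by rewrite in_cons in_fset_set// mem_set// orbT.
by rewrite card_le_II ltnS geq_card_fset_set.
Qed.

(** Concatenating enumerations of the sets [C y], for [y] in [B], lists all of [A], possibly with
    repetitions, in length at most [m * k]. *)
Lemma card_le_bigcup (T U : choiceType) (A : set T) (B : set U)
    (C : U -> set T) (m k : nat) :
  (B #<= `I_m)%card -> (forall y, B y -> C y #<= `I_k)%card ->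
  A `<=` \bigcup_(y in B) C y -> (A #<= `I_(m * k))%card.
Proof.
move=> Bm Ck AC.
have finB : finite_set B by apply/finite_set_leP; exists m.
have finC y : B y -> finite_set (C y).
  by move=> By; apply/finite_set_leP; exists k; exact: Ck.
pose t := flatten
  [seq finmap.enum_fset (fset_set (C y)) | y <- finmap.enum_fset (fset_set B)].
apply: (@card_le_trans _ _ _ `I_(size t)).
  apply: card_le_seq => x /AC[y By Cyx]; apply/flatten_mapP; exists y.
    by rewrite in_fset_set// inE.
  by rewrite in_fset_set ?inE//; exact: finC.
rewrite card_le_II; apply: leq_trans (leq_mul (geq_card_fset_set Bm) (leqnn k)).
rewrite /t; have: {subset finmap.enum_fset (fset_set B) <= B}.
  by move=> y; rewrite in_fset_set.
elim: (finmap.enum_fset (fset_set B)) => //= y s IHs sB.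
rewrite size_cat mulSn leq_add//; last first.
  by apply: IHs => z zs; apply: sB; rewrite in_cons zs orbT.
apply: geq_card_fset_set; apply: Ck; have := sB y (mem_head _ _).
by rewrite inE.
Qed.

Lemma bounded_degree_sub (X : Type) (E E' : set (X * X)) : E `<=` E' ->
  bounded_degree E' -> bounded_degree E.
Proof.
move=> EE' [N NP]; exists N => x; apply: card_le_trans (NP x).
by apply: subset_card_le => y /EE'.
Qed.

(** * Levels, parents and rays in a rooted graph *)

Section Graph.
Variables (X : countType) (G : rooted_graph X).

(** A shortest walk exists as soon as some walk does, so the default value of [xget] is never
    taken. *)
Lemma graph_distP (E : set (X * X)) (x y : X) n : walk E x y n ->
  walk E x y (graph_dist E x y) /\
  forall m, walk E x y m -> (graph_dist E x y <= m)%N.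
Proof.
move=> xyn; have ex : exists n, `[< walk E x y n >] by exists n; apply/asboolP.
apply: (@xgetPex _ 0%N [set n | walk E x y n /\
  forall m, walk E x y m -> (n <= m)%N]).
case: (ex_minnP ex) => k /asboolP xyk kmin.
by exists k; split=> // m xym; apply: kmin; apply/asboolP.
Qed.

Lemma level_walk x : walk (edge G) (graph_root G) x (level G x).
Proof. by have [n /graph_distP[]] := edge_connected G (graph_root G) x. Qed.

Lemma level_le x n : walk (edge G) (graph_root G) x n -> (level G x <= n)%N.
Proof. by move=> wx; have [_] := graph_distP wx; apply. Qed.

Lemma level_edge x y : edge G (x, y) -> (level G y <= (level G x).+1)%N.
Proof.
move=> xy; have [s [ps sx <-]] := level_walk x.
apply: level_le; exists (rcons s y); split; last by rewrite size_rcons.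
  by rewrite rcons_path ps sx; apply/asboolP.
by rewrite last_rcons.
Qed.

Lemma level_eq0 x : level G x = 0%N -> x = graph_root G.
Proof. by have [[|? s] [_ <- <-]] := level_walk x. Qed.

Lemma level_root : level G (graph_root G) = 0%N.
Proof. by apply/eqP; rewrite -leqn0; apply: level_le; exists [::]. Qed.

(** The parent is the penultimate vertex of a shortest walk from the root: the truncated walk gives
    level at most [n], and levels grow by at most one along an edge. *)
Lemma exists_parent y n : level G y = n.+1 ->
  exists2 x, children G x y & level G x = n.
Proof.
move=> yn; have := level_walk y; rewrite yn => -[s []].
case/lastP: s => // s z; rewrite rcons_path last_rcons size_rcons.
move=> /andP[ps /asboolP xz] zy [sn]; rewrite zy in xz.
have xn : (level G (last (graph_root G) s) <= n)%N.
  by apply: level_le; exists s.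
have nx : (n <= level G (last (graph_root G) s))%N.
  by have := level_edge xz; rewrite yn.
have xE : level G (last (graph_root G) s) = n.
  by apply/eqP; rewrite eqn_leq xn.
by exists (last (graph_root G) s) => //; split=> //; rewrite yn xE.
Qed.

Lemma ray_through (x : X) : (forall y, children G y !=set0) ->
  exists u, [/\ ray G u, forall n, level G (u n) = n & u (level G x) = x].
Proof.
move=> /choice[ch chP].
have /choice[par parP] y : exists z, y <> graph_root G -> children G z y.
  case E : (level G y) => [|n]; first by exists y => /(_ (level_eq0 E)).
  by have [z zy _] := exists_parent E; exists z.
pose n := level G x.
have level_par i : (i <= n)%N -> level G (iter i par x) = (n - i)%N.
  elim: i => [|i IHi] i_n; first by rewrite subn0.
  have [|_] := parP (iter i par x).
    move=> E; have := IHi (ltnW i_n).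
    by rewrite E level_root => /esym/eqP; rewrite subn_eq0 leqNgt i_n.
  by rewrite IHi 1?ltnW// subnS /= => ->.
(* Truncated subtraction glues two paths: for [i <= n] only [par] is iterated, giving the ancestor
   of [x] on level [i]; for [i >= n] only [ch] is, giving a descendant. *)
pose u i := iter (i - n) ch (iter (n - i) par x).
have uP i : children G (u i) (u i.+1).
  rewrite /u; have [i_n|n_i] := ltnP i n.
    have -> : (i.+1 - n = 0)%N by apply/eqP; rewrite subn_eq0.
    have -> : (i - n = 0)%N by apply/eqP; rewrite subn_eq0 ltnW.
    rewrite -(subnSK i_n) /=.
    apply: parP => E; have := level_par (n - i.+1)%N (leq_subr _ _).
    by rewrite E level_root subKn.
  have -> : (n - i.+1 = 0)%N by apply/eqP; rewrite subn_eq0 leqW.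
  have -> : (n - i = 0)%N by apply/eqP; rewrite subn_eq0.
  by rewrite subSn//=; exact: chP.
have u0 : u 0%N = graph_root G.
  by apply: level_eq0; rewrite /u sub0n subn0 /= level_par// subnn.
exists u; split=> // [i|]; last by rewrite /u subnn.
by elim: i => [|i IHi]; rewrite ?u0 ?level_root// (uP i).2 IHi.
Qed.

End Graph.

(** * Diameters and distances of sets *)

Section Metric.
Variables (R : realType) (M : metricType R).

Lemma mdist_le_diam (A : set M) p q : A p -> A q ->
  ((mdist p q)%:E <= diam A)%E.
Proof.
by move=> Ap Aq; apply: ereal_sup_ubound; right; exists p => //; exists q.
Qed.

Lemma diam_le (A : set M) r : 0 <= r ->
  (forall p q, A p -> A q -> mdist p q <= r) -> (diam A <= r%:E)%E.
Proof.
move=> r0 Ar; apply: ge_ereal_sup => _ [->|[p Ap [q Aq <-]]].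
  by rewrite lee_fin.
by rewrite lee_fin; exact: Ar.
Qed.

Lemma set_dist_le (A B : set M) p q : A p -> B q -> set_dist A B <= mdist p q.
Proof.
move=> Ap Bq; apply: ge_inf; last by exists p => //; exists q.
by exists 0 => _ [? _ [? _ <-]]; exact: mdist_ge0.
Qed.

Lemma set_dist_lt (A B : set M) r : A !=set0 -> B !=set0 -> set_dist A B < r ->
  exists p q, [/\ A p, B q & mdist p q < r].
Proof.
move=> [p Ap] [q Bq] /inf_lt[]; first by exists (mdist p q), p => //; exists q.
by move=> _ [p' Ap' [q' Bq' <-]] ?; exists p', q'.
Qed.

Lemma compact_mdist_bounded (A : set M) : compact A ->
  exists D, forall p q, A p -> A q -> mdist p q <= D.
Proof.
move=> /compact_near_coveringP cA.
have [->|/set0P[z Az]] := eqVneq A set0; first by exists 0.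
(* Compactness is used as a near-covering property: around each [y] in [A], the unit ball lies
   within distance [r] of [z] for all large [r]. *)
have : \forall r \near +oo, A `<=` [set y | mdist z y < r].
  apply: cA => y Ay; near=> y' r.
  have yy' : mdist y y' < 1.
    by near: y'; have := nbhsx_ballx y 1 ltr01; rewrite ballEmdist.
  have : mdist z y + 1 < r by near: r; apply: nbhs_pinfty_gt; exact: num_real.
  apply: le_lt_trans; apply: le_trans (metric_triangle z y y') _.
  by rewrite lerD2l ltW.
move=> /(@filter_ex _ _ _)[r Ar]; exists (r + r) => p q /Ar/= zp /Ar/= zq.
apply: le_trans (metric_triangle p z q) _; rewrite metric_sym.
by rewrite lerD// ltW.
Unshelve. all: by end_near.
Qed.

End Metric.

(** * Index maps and the degrees of augmented graphs *)

Section AI.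
Variables (R : realType) (M : metricType R) (X : countType).
Variables (G : rooted_graph X) (Phi : X -> set M) (b gamma : R).
Hypotheses (Phi_index : is_index_map G Phi) (b_gt0 : 0 < b).

Lemma Phi_sub_root x : Phi x `<=` Phi (graph_root G).
Proof.
move: {-1}(level G x) (erefl (level G x)) => n.
elim: n x => [|n IHn] x => [/level_eq0 ->//|/exists_parent[y yx yn]].
by apply: subset_trans (IHn _ yn); exact: (index_map_nested Phi_index yx).
Qed.

Lemma cell_sub x y : children G x y -> cell G Phi y `<=` cell G Phi x.
Proof. by move=> xy; apply: setSI; exact: (index_map_nested Phi_index xy). Qed.

(** The point shared by all [Phi (u i)] along a ray [u] through [x] lies in a set of every level,
    hence in the attractor. *)
Lemma cell_nonempty x : (forall y, children G y !=set0) -> cell G Phi x !=set0.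
Proof.
move=> /(ray_through x)[u [ray_u uP ux]].
have [z uz] := index_map_ray Phi_index ray_u.
have zu i : Phi (u i) z.
  by have : [set z] z by []; rewrite -uz; apply.
exists z; split; first by rewrite -ux.
by move=> n _; exists (u n) => //; exact: uP.
Qed.

Lemma exponential_diam : exponential_type G Phi b ->
  exists2 C : R, 0 <= C &
    forall x p q, Phi x p -> Phi x q ->
      mdist p q <= C * expR (- (b * (level G x)%:R)).
Proof.
move=> [C [N _ NC]].
have [D0 D0P] : exists D, forall p q,
    Phi (graph_root G) p -> Phi (graph_root G) q -> mdist p q <= D.
  by apply: compact_mdist_bounded; apply: index_map_compact Phi_index _.
pose D := Num.max 0 D0.
have DP x p q : Phi x p -> Phi x q -> mdist p q <= D.
  move=> /Phi_sub_root xp /Phi_sub_root xq.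
  by rewrite le_max D0P ?orbT.
(* The factor [expR (b * N%:R)] absorbs the decay on the levels below [N], where only the uniform
   bound [D] is available. *)
exists (Num.max (Num.max 0 C) (D * expR (b * N%:R))).
  by rewrite !le_max lexx.
move=> x p q xp xq; have [Nx|xN] := leqP N (level G x).
  have /(le_trans (mdist_le_diam xp xq)) := NC _ Nx x erefl.
  rewrite lee_fin => /le_trans; apply; rewrite ler_wpM2r ?expR_ge0//.
  by rewrite !le_max lexx orbT.
apply: le_trans (DP _ _ _ xp xq) _.
apply: (@le_trans _ _ (D * expR (b * N%:R) * expR (- (b * (level G x)%:R)))).
  rewrite -mulrA -expRD ler_peMr ?le_max ?lexx//.
  rewrite -[leLHS]expR0 ler_expR subr_ge0 ler_wpM2l ?(ltW b_gt0)//.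
  by rewrite ler_nat ltnW.
by rewrite ler_wpM2r ?expR_ge0// le_max lexx orbT.
Qed.

Lemma AI_edge_level x y : level G x = level G y ->
    x <> y -> (0 < level G x)%N ->
    set_dist (Phi x) (Phi y) <= gamma * expR (- (b * (level G x)%:R)) ->
  AI_edge G Phi b gamma (x, y).
Proof. by move=> xy ? ? ?; right; exists (level G x). Qed.

Lemma condition_S_bounded_degree :
    vertical G -> (forall x, children G x !=set0) ->
    exponential_type G Phi b -> 0 < gamma ->
  condition_S G Phi b -> bounded_degree (AI_edge G Phi b gamma).
Proof.
move=> vG chG /exponential_diam[C C0 CP] g0 SG.
(* At scale [e], the cell of a horizontal neighbour of [x] is within [r] of [Phi x], and the
   [r]-neighbourhood [F] of [Phi x] has diameter at most [r + C + r]. The summand 1 makes the bound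
   strict, and [expR b] pays for level [n.+1]. *)
pose r := gamma *+ 2 + C; pose c := (r + C + r + 1) * expR b.
have r0 : 0 <= r by rewrite addr_ge0// mulrn_wge0// ltW.
have s0 : 0 <= r + C + r by do 2![apply: addr_ge0 => //].
have c0 : 0 < c by rewrite mulr_gt0 ?expR_gt0// ltr_wpDl.
have [l lP] := SG c c0; exists (3 * l)%N => x.
pose n := level G x; pose e := expR (- (b * n%:R)).
pose F := [set z | exists2 p, Phi x p & mdist p z <= r * e].
have xF : Phi x `<=` F.
  by move=> p xp; exists p => //; rewrite mdistxx mulr_ge0 ?expR_ge0.
have diamF i : (i <= n.+1)%N -> (diam F < (c * expR (- (b * i%:R)))%:E)%E.
  move=> i_n; apply: (@le_lt_trans _ _ ((r + C + r) * e)%:E).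
    apply: diam_le; first by rewrite mulr_ge0 ?expR_ge0.
    move=> p q [p' xp' pp'] [q' xq' qq'].
    apply: le_trans (metric_triangle p q' q) _; rewrite mulrDl lerD//.
    apply: le_trans (metric_triangle p p' q') _; rewrite mulrDl lerD//.
      by rewrite metric_sym.
    exact: CP.
  rewrite lte_fin /c -mulrA -expRD.
  apply: (@lt_le_trans _ _ ((r + C + r + 1) * e)).
    by rewrite ltr_pM2r ?expR_gt0// ltrDl.
  apply: ler_wpM2l; first exact: addr_ge0.
  have : b * i%:R <= b * n.+1%:R by rewrite ler_wpM2l ?ler_nat ?(ltW b_gt0).
  rewrite ler_expR -natr1 mulrDr mulr1; lra.
(* At the root [n.-1] equals [n]; the repetition is harmless, since the list still bounds the number
   of levels by 3. *)
have FP i : i \in [:: n.-1; n; n.+1] ->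
    ([set y | sphere G i y /\ cell G Phi y `&` F !=set0] #<= `I_l)%card.
  move=> i_n; apply/lP/diamF; move: i_n.
  by rewrite !inE => /or3P[] /eqP->//; rewrite leqW// leq_pred.
apply: (card_le_bigcup (card_le_seq (@subset_refl _ _)) FP).
move=> y [xy|]/=; last first.
  move=> [i _ [/= xi yi _ d]]; exists i; first by rewrite /= !inE -xi eqxx orbT.
  split=> //; have [z [yz Az]] := cell_nonempty y chG.
  exists z; split; first by split.
  (* Doubling [gamma] turns the weak bound on [set_dist] into a strict one, so that two actual
     points satisfy it. *)
  have [|||p [q [xp yq pq]]] :=
      @set_dist_lt _ _ (Phi x) (Phi y) (gamma *+ 2 * e).
  - exact: index_map_nonempty Phi_index _.
  - exact: index_map_nonempty Phi_index _.
  - apply: le_lt_trans d _; rewrite -xi ltr_pM2r ?expR_gt0//.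
    by rewrite mulr2n ltrDl.
  exists p => //; apply: le_trans (metric_triangle p q z) _.
  rewrite mulrDl; apply: lerD; first exact: ltW.
  by apply: le_trans (CP _ _ _ yq yz) _; rewrite yi -xi.
exists (level G y).
  rewrite /= !inE -/n.
  have := level_edge xy; have := level_edge (edge_sym xy).
  rewrite -/n; have := vG _ _ xy; rewrite -/n; lia.
(* By verticality one of [x], [y] is the child of the other. Any point of the child's cell lies in
   [cell G Phi y] and in [Phi x], hence in [F]. *)
split=> //; case: (ltngtP (level G x) (level G y)) => [xly|ylx|]; last first.
- by move=> /(vG _ _ xy).
- have yx : children G y x.
    split; first exact: edge_sym.
    by apply/eqP; rewrite eqn_leq ylx level_edge//; exact: edge_sym.
  have [z xz] := cell_nonempty x chG; exists z; split; last exact/xF/xz.1.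
  exact: (cell_sub yx).
- have yx : children G x y.
    split => //.
    by apply/eqP; rewrite eqn_leq xly level_edge.
  have [z yz] := cell_nonempty y chG; exists z; split=> //.
  by apply/xF; exact: (index_map_nested Phi_index yx yz.1).
Qed.

Lemma bounded_degree_condition_S : 0 < gamma ->
  bounded_degree (AI_edge G Phi b gamma) -> condition_S G Phi b.
Proof.
move=> g0 [N NP].
(* Level 0 is treated apart: horizontal edges start at level 1, and the root has no parent. *)
have count_root F :
    ([set x | sphere G 0 x /\ cell G Phi x `&` F !=set0] #<= `I_1)%card.
  apply: (@card_le_seq _ _ [:: graph_root G]) => x [/level_eq0 -> _].
  exact: mem_head.
have count k : forall n F,
    (diam F < (gamma * expR (b * k%:R) * expR (- (b * n%:R)))%:E)%E ->
    ([set x | sphere G n x /\ cell G Phi x `&` F !=set0]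
      #<= `I_(N.+1 ^ k.+1))%card.
  elim: k => [|k IHk] [|n] F.
  - move=> _; apply: card_le_trans (count_root F) _.
    by rewrite card_le_II expn_gt0.
  - rewrite mulr0 expR0 mulr1 expn1 => dF.
    set A := [set x | _].
    (* Once one vertex [x] is counted, every other one is adjacent to it, whence [N.+1]. *)
    have [->|/set0P[x [xn [p [xp Fp]]]]] := eqVneq A set0.
      exact: card_ge0.
    apply: card_le_trans (card_leU1 x (NP x)).
    apply: subset_card_le => y [yn [q [yq Fq]]].
    have [->|/eqP xy] := eqVneq y x; [by left|right].
    apply: AI_edge_level; [by rewrite xn yn|by move=> /esym|by rewrite xn|].
    apply: le_trans (set_dist_le xp.1 yq.1) _.
    rewrite xn -lee_fin; apply: le_trans (mdist_le_diam Fp Fq) _.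
    exact: ltW.
  - move=> _; apply: card_le_trans (count_root F) _.
    by rewrite card_le_II expn_gt0.
  - move=> dF; rewrite expnSr.
    apply: (@card_le_bigcup _ _ _ _
      (fun y => [set x | AI_edge G Phi b gamma (y, x)])).
    (* Raising both [k] and [n] by one leaves the bound on the diameter unchanged, so the same [F]
       serves for the parents. *)
    + apply: (IHk n F); move: dF.
      rewrite -!mulrA -!expRD -!natr1 !mulrDr opprD addrACA mulr1.
      by rewrite subrr addr0.
    + by move=> y _; apply: card_le_trans (NP y) _; rewrite card_le_II.
    + move=> x [/exists_parent[y yx yn] [p [xp Fp]]]; exists y.
        by split=> //; exists p; split=> //; exact: (cell_sub yx xp).
      by left; exact: yx.1.
move=> c c0; have [k ck] : exists k : nat, c <= gamma * expR (b * k%:R).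
  (* With [k > c / (gamma * b)] one gets [c <= gamma * (b * k) <= gamma * expR (b * k)], from
     [1 + t <= expR t]. *)
  exists (Num.bound (c / (gamma * b))).
  set k := Num.bound _.
  have : c / (gamma * b) < k%:R.
    by rewrite archi_boundP// divr_ge0 ?mulr_ge0// ltW.
  rewrite ltr_pdivrMr ?mulr_gt0// mulrCA => /ltW/le_trans; apply.
  rewrite ler_pM2l// mulrC; apply: le_trans (expR_ge1Dx _).
  by rewrite lerDr.
exists (N.+1 ^ k.+1)%N => n F dF; apply: count; apply: lt_le_trans dF _.
by rewrite lee_fin ler_wpM2r ?expR_ge0.
Qed.

(** A common point [z] bounds [set_dist] by [mdist z z = 0]. *)
Lemma AI_infty_edge_sub : 0 <= gamma ->
  AI_infty_edge G Phi `<=` AI_edge G Phi b gamma.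
Proof.
move=> g0 p [|[n n0 [np nq pq [z [z1 z2]]]]]; [by left|right].
exists n => //; split=> //; apply: le_trans (set_dist_le z1 z2) _.
by rewrite mdistxx mulr_ge0 ?expR_ge0.
Qed.

End AI.

Theorem theorem1p5 (R : realType) (M : metricType R) (X : countType)
    (G : rooted_graph X) (Phi : X -> set M) (b gamma : R)
    (M_complete : complete_metric M)
    (G_vertical : vertical G)
    (G_children : forall x : X, children G x !=set0)
    (Phi_index : is_index_map G Phi)
    (b_gt0 : 0 < b)
    (Phi_exp : exponential_type G Phi b)
    (gamma_gt0 : 0 < gamma) :
  (bounded_degree (AI_edge G Phi b gamma) <-> condition_S G Phi b) /\
  (condition_S G Phi b -> bounded_degree (AI_infty_edge G Phi)).
Proof.
have SD := condition_S_bounded_degree Phi_index b_gt0 G_vertical G_children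
  Phi_exp gamma_gt0.
split; first by split=> //; exact: bounded_degree_condition_S.
by move=> /SD; apply: bounded_degree_sub; apply: AI_infty_edge_sub; exact: ltW.
Qed.
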